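(* Let $D$ be a weakly locally finite division ring with center $F$, let $n\ge2$, and let $N$ be an infinite subnormal subgroup of $\mathrm{GL}_n(D)$. If $N$ is finitely generated, then $N\subseteq F^*I=\{\alpha I\mid \alpha\in F^*\}$, where $I$ is the identity matrix.
   Context: A division ring $D$ is weakly locally finite if for every finite subset $S\subseteq D$, the division subring generated by $S$ is finite dimensional over its own center. *)

(* Defs.v *)
From HB Require Import structures.
From mathcomp Require Import all_boot all_order all_algebra.
Set Implicit Arguments. Unset Strict Implicit. Unset Printing Implicit Defensive.
Import GRing.Theory.
Local Open Scope ring_scope.

Section DivisionRings.
Variable R : unitRingType.

Definition is_division_ring : Prop := forall x : R, x != 0 -> x \is a GRing.unit.

Definition division_subring (S : R -> Prop) : Prop :=
  [/\ S 0, S 1,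
      (forall x y, S x -> S y -> S (x - y)),
      (forall x y, S x -> S y -> S (x * y)) &
      (forall x, S x -> x != 0 -> S x^-1)].

Definition divgen (s : seq R) (x : R) : Prop :=
  forall S, division_subring S -> (forall y, y \in s -> S y) -> S x.

Definition center_of (K : R -> Prop) (z : R) : Prop :=
  K z /\ forall y, K y -> z * y = y * z.

Definition fin_dim_over (K Z : R -> Prop) : Prop :=
  exists b : seq R, (forall y, y \in b -> K y) /\
    forall x, K x -> exists c : seq R,
      [/\ size c = size b, (forall i, (i < size c)%N -> Z (nth 0 c i)) &
          x = \sum_(i < size b) nth 0 c i * nth 0 b i].

Definition weakly_locally_finite : Prop :=
  forall s : seq R, fin_dim_over (divgen s) (center_of (divgen s)).

Definition central (z : R) : Prop := forall y : R, z * y = y * z.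

Variable n : nat.
Notation M := ('M[R]_n).

Definition invertible (A : M) : Prop :=
  exists B : M, A *m B = 1%:M /\ B *m A = 1%:M.

Definition GL : M -> Prop := invertible.

Definition is_subgroup (H G : M -> Prop) : Prop :=
  [/\ (forall A, H A -> G A), H 1%:M,
      (forall A B, H A -> H B -> H (A *m B)) &
      (forall A B, H A -> A *m B = 1%:M -> B *m A = 1%:M -> H B)].

Definition is_normal (H G : M -> Prop) : Prop :=
  is_subgroup H G /\
  forall A B Bi, H A -> G B -> B *m Bi = 1%:M -> Bi *m B = 1%:M ->
    H (Bi *m A *m B).

Definition subnormal_GL (N : M -> Prop) : Prop :=
  exists (k : nat) (C : nat -> M -> Prop),
    [/\ (forall A, C 0%N A <-> N A), (forall A, C k A <-> GL A) &
        (forall i, (i < k)%N -> is_normal (C i) (C i.+1))].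

Definition infinite_set (N : M -> Prop) : Prop :=
  ~ exists s : seq M, forall A, N A -> A \in s.

Definition gen_subgroup (s : seq M) (A : M) : Prop :=
  forall H, is_subgroup H GL -> (forall B, B \in s -> H B) -> H A.

Definition finitely_generated (N : M -> Prop) : Prop :=
  exists s : seq M, forall A, N A <-> gen_subgroup s A.

End DivisionRings.

(* Main.v *)
From HB Require Import structures.
Require Import Defs.
From mathcomp Require Import all_boot all_order all_algebra.
From mathcomp Require Import boolp.
Set Implicit Arguments. Unset Strict Implicit. Unset Printing Implicit Defensive.
Import GRing.Theory.
Local Open Scope ring_scope.

(** Since [N] is infinite, so is [D].  If [N] were not scalar, Iwasawa's argument
    applied down the subnormal chain would show that [N] contains every
    transvection: a nonscalar subgroup [H] normalized by the transvections is
    transitive on the lines of [D^n], hence modulo [H] all transvections come from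
    the abelian group of those with a fixed center, and every transvection is a
    product of commutators.  The entries of finitely many generators of [N] and of
    their inverses then generate [D] as a ring, so weak local finiteness makes [D]
    finite dimensional over its center [F].  By Artin-Tate [F] is finitely
    generated as a ring; a field with this property is finite (Zariski), hence
    [D] is finite, a contradiction. *)

(** * Subrings, integrality and localization *)

Definition subring_pred (R : nzRingType) (S : R -> Prop) : Prop :=
  [/\ S 1, (forall x y, S x -> S y -> S (x - y)) &
      (forall x y, S x -> S y -> S (x * y))].

Definition ring_gen (R : nzRingType) (B : R -> Prop) (x : R) : Prop :=
  forall S, subring_pred S -> (forall y, B y -> S y) -> S x.

Section SubringPred.
Variables (R : nzRingType) (S : R -> Prop) (subS : subring_pred S).

Lemma subring_pred1 : S 1. Proof. by case: subS. Qed.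

Lemma subring_predB x y : S x -> S y -> S (x - y).
Proof. by case: subS => _ h _; apply: h. Qed.

Lemma subring_predM x y : S x -> S y -> S (x * y).
Proof. by case: subS => _ _ h; apply: h. Qed.

Lemma subring_pred0 : S 0.
Proof. by rewrite -(subrr 1); apply: subring_predB; apply: subring_pred1. Qed.

Lemma subring_predN x : S x -> S (- x).
Proof. by rewrite -sub0r => ?; apply: subring_predB; first apply: subring_pred0. Qed.

Lemma subring_predD x y : S x -> S y -> S (x + y).
Proof. by move=> Sx /subring_predN Sy; rewrite -[y]opprK; apply: subring_predB. Qed.

Lemma subring_predX x k : S x -> S (x ^+ k).
Proof.
move=> Sx; elim: k => [|k IH]; first exact: subring_pred1.
by rewrite exprS; apply: subring_predM.
Qed.

Lemma subring_pred_sum I (r : seq I) (P : pred I) (F : I -> R) :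
  (forall i, P i -> S (F i)) -> S (\sum_(i <- r | P i) F i).
Proof.
move=> SF; apply: big_ind SF; [exact: subring_pred0 | exact: subring_predD].
Qed.

Lemma subring_pred_poly : subring_pred (fun p : {poly R} => forall i, S p`_i).
Proof.
split=> [i|p q Sp Sq i|p q Sp Sq i].
- by rewrite coefC; case: eqP => _; [apply: subring_pred1 | apply: subring_pred0].
- by rewrite coefB; apply: subring_predB.
- by rewrite coefM; apply: subring_pred_sum => j _; apply: subring_predM.
Qed.

Lemma subring_pred_polyX i : S ('X : {poly R})`_i.
Proof.
by rewrite coefX; case: (i == 1%N); [apply: subring_pred1 | apply: subring_pred0].
Qed.

Lemma subring_pred_polyC c i : S c -> S (c%:P : {poly R})`_i.
Proof. by move=> Sc; rewrite coefC; case: (i == 0%N) => //; apply: subring_pred0. Qed.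

Lemma subring_pred_horner (p : {poly R}) x :
  (forall i, S p`_i) -> S x -> S p.[x].
Proof.
move=> Sp Sx; rewrite horner_coef; apply: subring_pred_sum => i _.
by apply: subring_predM => //; apply: subring_predX.
Qed.

End SubringPred.

Section SubringType.
Variables (K : comNzRingType) (S : K -> Prop) (subS : subring_pred S).

(** Taking the closure proof as an argument ties the predicate to its closure properties, so that a
    subring structure can be registered for it. *)
Definition subring_mem (_ : subring_pred S) : {pred K} := fun x => `[< S x >].

Fact subring_mem_closed : subring_closed (subring_mem subS).
Proof.
split=> [|x y /asboolP Sx /asboolP Sy|x y /asboolP Sx /asboolP Sy]; apply/asboolP.
- exact: subring_pred1.
- exact: subring_predB.
- exact: subring_predM.
Qed.

HB.instance Definition _ :=
  GRing.isSubringClosed.Build K (subring_mem subS) subring_mem_closed.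

Definition subring_type := {x : K | x \in subring_mem subS}.
HB.instance Definition _ := SubChoice.on subring_type.
HB.instance Definition _ := [SubChoice_isSubComNzRing of subring_type by <:].

Lemma subring_type_val (x : subring_type) : S (val x).
Proof. by have /asboolP := valP x. Qed.

Lemma subring_type_lift x : S x -> exists y : subring_type, val y = x.
Proof. by move=> /asboolP Sx; exists (Sub x Sx); rewrite SubK. Qed.

Lemma subring_poly_lift (p : {poly K}) : (forall i, S p`_i) ->
  exists q : {poly subring_type}, map_poly val q = p.
Proof.
move=> Sp; exists (\poly_(i < size p) insubd (0 : subring_type) p`_i).
apply/polyP=> i; rewrite coef_map coef_poly.
case: ltnP => [_|le_pi]; last by rewrite raddf0 nth_default.
by apply: insubdK; apply/asboolP.
Qed.

Lemma subring_monic_lift (q : {poly subring_type}) :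
  map_poly val q \is monic -> q \is monic.
Proof.
have lead_q : lead_coef (map_poly val q) = val (lead_coef q).
  exact: (lead_coef_map_inj val_inj).
by rewrite !monicE lead_q -(inj_eq val_inj).
Qed.

(** Polynomials stay over [K], so that the base [S] can change by adjunction and localization
    without a change of type; [integralP] is the bridge to [integralOver]. *)
Definition integral x :=
  exists p : {poly K}, [/\ p \is monic, (forall i, S p`_i) & root p x].

Lemma integralP x : integral x <-> integralOver (val : subring_type -> K) x.
Proof.
split=> [[p [mon_p Sp px0]]|[p mon_p px0]].
  have [q qE] := subring_poly_lift Sp; exists q; last by rewrite qE.
  by apply: subring_monic_lift; rewrite qE.
exists (map_poly val p); split=> //; first exact: monic_map.
by move=> i; rewrite coef_map; apply: subring_type_val.
Qed.

Lemma integral_base x : S x -> integral x.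
Proof. by move=> /subring_type_lift[y <-]; apply/integralP; apply: integral_id. Qed.

Lemma integral_subring : subring_pred integral.
Proof.
split=> [|x y /integralP ix /integralP iy|x y /integralP ix /integralP iy].
- by apply: integral_base; apply: subring_pred1.
- by apply/integralP; apply: integral_sub.
- by apply/integralP; apply: integral_mul.
Qed.

Lemma integral_trans x (p : {poly K}) :
  p \is monic -> (forall i, integral p`_i) -> root p x -> integral x.
Proof.
move=> mon_p ip px0; apply/integralP; apply: integral_root_monic mon_p px0 _.
by apply/integral_poly => i; apply/integralP.
Qed.

Definition adjoin a x := exists2 p : {poly K}, (forall i, S p`_i) & x = p.[a].

Lemma adjoin_subring a : subring_pred (adjoin a).
Proof.
have [S1 SB SM] := subring_pred_poly subS.
split=> [|_ _ [p Sp ->] [q Sq ->]|_ _ [p Sp ->] [q Sq ->]].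
- by exists 1; rewrite ?hornerC.
- by exists (p - q); [apply: SB | rewrite hornerD hornerN].
- by exists (p * q); [apply: SM | rewrite hornerM].
Qed.

Lemma adjoin_base a x : S x -> adjoin a x.
Proof. by exists x%:P; [move=> i; apply: subring_pred_polyC | rewrite hornerC]. Qed.

Lemma adjoin_gen a : adjoin a a.
Proof. by exists 'X; [apply: subring_pred_polyX | rewrite hornerX]. Qed.

(** For invertible [f] this is the subring S[1/f] of [K], described by clearing denominators. *)
Definition localize f x := exists k, S (x * f ^+ k).

Lemma localize_subring f : S f -> subring_pred (localize f).
Proof.
move=> Sf; split=> [|x y [k Sx] [l Sy]|x y [k Sx] [l Sy]].
- by exists 0%N; rewrite mulr1; apply: subring_pred1.
- exists (k + l)%N; rewrite mulrBl; apply: subring_predB => //.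
    by rewrite exprD mulrA; apply: subring_predM => //; apply: subring_predX.
  by rewrite addnC exprD mulrA; apply: subring_predM => //; apply: subring_predX.
- by exists (k + l)%N; rewrite exprD mulrACA; apply: subring_predM.
Qed.

Lemma localize_base f x : S x -> localize f x.
Proof. by exists 0%N; rewrite mulr1. Qed.

End SubringType.

Lemma integral_mono (K : comNzRingType) (S S' : K -> Prop) x :
  (forall y, S y -> S' y) -> integral S x -> integral S' x.
Proof.
by move=> sSS' [p [mon_p Sp px0]]; exists p; split=> // i; apply: sSS'.
Qed.

Lemma localize_mulr (K : comNzRingType) (S : K -> Prop) f g x :
  subring_pred S -> S g -> localize S f x -> localize S (f * g) x.
Proof.
move=> subS Sg [k Sx]; exists k; rewrite exprMn mulrA.
by apply: subring_predM => //; apply: subring_predX.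
Qed.

(** Multiplying a monic equation of degree d + 1 for [x^-1] by [x ^+ d] writes [x^-1] as a
    polynomial in [x] over [S]. *)
Lemma integral_inv_mem (K : fieldType) (S : K -> Prop) x :
  subring_pred S -> S x -> integral S x^-1 -> S x^-1.
Proof.
move=> subS Sx [p [mon_p Sp]].
have [->|x0] := eqVneq x 0; first by rewrite invr0 => _; apply: subring_pred0.
rewrite rootE horner_coef.
case sz_p: (size p) => [|d].
  by move: (monic_neq0 mon_p); rewrite -size_poly_eq0 sz_p.
rewrite big_ord_recr /=.
have -> : p`_d = 1 by rewrite -(eqP mon_p) lead_coefE sz_p.
rewrite mul1r addrC addr_eq0 => /eqP.
case: d sz_p => [|d] sz_p.
  by rewrite big_ord0 oppr0 => /eqP; rewrite oner_eq0.
move=> /(congr1 (fun y => y * x ^+ d)).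
rewrite exprS -mulrA -exprMn mulVf // expr1n mulr1 => ->.
rewrite mulNr; apply: subring_predN => //; rewrite mulr_suml.
apply: subring_pred_sum => // i _; rewrite -mulrA; apply: subring_predM => //.
have le_id : (i <= d)%N by rewrite -ltnS.
have -> : x ^+ d = x ^+ i * x ^+ (d - i) by rewrite -exprD subnKC.
rewrite mulrA -exprMn mulVf // expr1n mul1r.
exact: subring_predX.
Qed.

(** * Fields finitely generated as rings *)

(** Factors X are divided out of [p] until the constant term is nonzero. The relation obtained
    expresses [f^-1] as [- q.[f] / c]. *)
Lemma root_nonzero_coef0 (K : fieldType) (S : K -> Prop) (p : {poly K}) f :
    subring_pred S -> f != 0 -> p != 0 -> (forall i, S p`_i) -> root p f ->
  exists2 q : {poly K}, (forall i, S q`_i) & exists2 c, S c /\ c != 0 &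
    q.[f] * f + c = 0.
Proof.
move=> subS f0; elim/poly_ind: p => [|p c IH]; first by rewrite eqxx.
move=> pXc0 SpXc rpXc.
have Sp i : S p`_i.
  by have := SpXc i.+1; rewrite coefD coefMX coefC /= addr0.
have Sc : S c by have := SpXc 0%N; rewrite coefD coefMX coefC /= add0r.
have {}rpXc : p.[f] * f + c = 0 by move/eqP: rpXc; rewrite hornerMXaddC.
have [c0|c0] := eqVneq c 0; last by exists p => //; exists c.
apply: IH => //.
  by apply: contraNneq pXc0 => ->; rewrite mul0r add0r c0.
by rewrite rootE -(mulIr_eq0 _ (mulIf f0)) -[_ * _]addr0 -c0 rpXc c0.
Qed.

Section Zariski.
Variable K : fieldType.
Implicit Types (A : K -> Prop) (s : seq K).

Lemma localize_inv A f : subring_pred A -> f != 0 -> localize A f f^-1.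
Proof. by move=> subA f0; exists 1%N; rewrite mulVf //; apply: subring_pred1. Qed.

(* If [a] were transcendental over [A], then [A[a][1/f]] would be a field in
   which [1 + a f], being coprime to [f], has no inverse. *)
Lemma transcendental_not_integral A a f :
    subring_pred A -> (forall p : {poly K}, (forall i, A p`_i) -> root p a -> p = 0) ->
    adjoin A a f -> f != 0 ->
  ~ (forall x, integral (localize (adjoin A a) f) x).
Proof.
move=> subA tr Af f0 int.
have subAa := adjoin_subring subA a.
have subL := localize_subring subAa Af.
have subP := subring_pred_poly subA.
have [P AP fE] := Af.
have P0 : P != 0 by apply: contraNneq f0 => P0; rewrite fE P0 horner0.
pose Q := 1 + 'X * P.
have sizeXP : size ('X * P) = (size P).+1 by rewrite mulrC size_mulX.
have sizeQ : size Q = (size P).+1.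
  rewrite /Q addrC size_polyDl ?sizeXP // size_poly1 ltnS.
  by rewrite lt0n size_poly_eq0.
have AQ : forall i, A Q`_i.
  apply: (subring_predD subP); first exact: (subring_pred1 subP).
  by apply: (subring_predM subP) => //; apply: subring_pred_polyX.
have Q0 : Q.[a] != 0.
  apply/eqP => Qa0; have : Q = 0 by apply: tr => //; apply/eqP.
  by move/eqP; rewrite -size_poly_eq0 sizeQ.
have LQ : localize (adjoin A a) f Q.[a] by apply: localize_base => //; exists Q.
have [k [h Ah hE]] := integral_inv_mem subL LQ (int _).
(* Here [Q.[a]^-1 * f ^+ k = h.[a]]; since [a] is transcendental this is an identity of polynomials.
   As [Q] is coprime to [P], it would have to be constant. *)
have PhQ : P ^+ k = h * Q.
  apply/eqP; rewrite -subr_eq0; apply/eqP; apply: tr.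
    apply: (subring_predB subP); first exact: (subring_predX subP).
    exact: (subring_predM subP).
  rewrite rootE hornerD hornerN hornerM -hE horner_exp -fE.
  by rewrite mulrAC mulVf // mul1r subrr.
have copQP : coprimep Q P.
  apply/Bezout_eq1_coprimepP; exists (1, - 'X).
  by rewrite /= mul1r /Q mulNr addrK.
have := coprimep_expr k copQP; rewrite PhQ.
rewrite coprimepMr coprimepp sizeQ eqSS size_poly_eq0 (negPf P0).
by rewrite andbF.
Qed.

(** A relative form of Zariski's lemma. By induction over A[a], the field is integral over some
    A[a][1/f]; then [a] must be algebraic over [A], and it remains to make both [a] and [f^-1]
    integral by inverting one element of [A]. *)
Lemma zariski A s :
    subring_pred A -> (forall x, ring_gen (fun y => A y \/ y \in s) x) ->
  exists2 f, A f /\ f != 0 & forall x, integral (localize A f) x.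
Proof.
elim: s A => [|a s IH] A subA gen.
  exists 1; first by split; [apply: subring_pred1 | apply: oner_neq0].
  move=> x; have Ax : A x by apply: gen => // y [].
  apply: integral_base; last exact: localize_base.
  by apply: localize_subring => //; apply: subring_pred1.
have subAa := adjoin_subring subA a.
have [f [Af f0] int] : exists2 f, adjoin A a f /\ f != 0 &
    forall x, integral (localize (adjoin A a) f) x.
  apply: IH => // x T subT genT; apply: (gen x) => // y [Ay|].
    by apply: genT; left; apply: adjoin_base.
  rewrite inE => /predU1P[->|sy]; apply: genT; last by right.
  by left; apply: adjoin_gen.
have [[q [Aq q0 qa0]]|tr] :=
    pselect (exists q : {poly K}, [/\ forall i, A q`_i, q != 0 & root q a]); last first.
  case: (transcendental_not_integral subA _ Af f0 int) => p Ap pa0.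
  by apply/eqP; apply: contrapT => /negP p0; apply: tr; exists p.
have g0 : lead_coef q != 0 by rewrite lead_coef_eq0.
set g := lead_coef q in g0.
have Ag : A g by rewrite /g lead_coefE.
have subLg := localize_subring subA Ag.
(* Dividing [q] by its leading coefficient [g] gives a monic equation of [a] over A[1/g]. *)
have inta : integral (localize A g) a.
  exists (g^-1 *: q); split.
  - by rewrite monicE lead_coefZ mulVf.
  - move=> i; rewrite coefZ; apply: subring_predM => //; first exact: localize_inv.
    exact: localize_base.
  - by rewrite rootE hornerZ (eqP qa0) mulr0.
have int_adj x B : subring_pred B -> (forall y, localize A g y -> B y) ->
    adjoin A a x -> integral B x.
  move=> subB sB [p Ap ->].
  apply: (integral_mono sB).
  apply: subring_pred_horner => //; first exact: integral_subring.
  by move=> i; apply: integral_base => //; apply: localize_base.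
have [p [mon_p Lp pf0]] := int_adj f _ subLg (fun _ => id) Af.
have [r Lr [c [Lc c0] rc]] :=
  root_nonzero_coef0 subLg f0 (monic_neq0 mon_p) Lp pf0.
have [k Ac] := Lc.
(* [c] lies only in A[1/g]; [c'] is its numerator in [A], so inverting [g * c'] inverts both [g] and
   [c], and then [f^-1 = - r.[f] / c] is integral. *)
pose c' := c * g ^+ k; have c'0 : c' != 0 by rewrite mulf_neq0 ?expf_neq0.
exists (g * c'); first by split; [apply: subring_predM | rewrite mulf_neq0].
have subL : subring_pred (localize A (g * c')).
  by apply: localize_subring => //; apply: subring_predM.
have sL y : localize A g y -> localize A (g * c') y by apply: localize_mulr.
have subI := integral_subring subL.
have intf : integral (localize A (g * c')) f^-1.
  have -> : f^-1 = - r.[f] * c^-1.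
    apply: (mulIf f0); rewrite mulVf // mulrAC mulNr.
    by move/eqP: rc; rewrite addr_eq0 => /eqP ->; rewrite opprK divff.
  apply: subring_predM => //.
    apply: subring_predN => //; apply: subring_pred_horner => //.
      by move=> i; apply: integral_base => //; apply: sL.
    exact: int_adj.
  apply: integral_base => //.
  have -> : c^-1 = g ^+ k * c'^-1.
    by rewrite /c' invfM mulrCA divff ?expf_neq0 // mulr1.
  apply: subring_predM => //.
    by apply: localize_base => //; apply: subring_predX.
  exists 1%N; rewrite mulrCA mulVf // mulr1 //.
(* The coefficients of [P] are elements of A[a] over powers of [f], hence integral over A[1/(g c')];
   transitivity of integrality concludes. *)
move=> x; have [P [mon_P LP Px0]] := int x.
apply: (integral_trans subL mon_P) Px0 => i.
have [l adjP] := LP i.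
have -> : P`_i = P`_i * f ^+ l * f^-1 ^+ l.
  by rewrite -mulrA -exprMn divff // expr1n mulr1.
apply: subring_predM => //; first exact: int_adj.
exact: subring_predX.
Qed.

End Zariski.

(** * Finiteness by covering lists, and integral extensions of finite rings *)

Definition covered (T : eqType) (P : T -> Prop) : Prop :=
  exists L : seq T, forall x, P x -> x \in L.

Lemma covered_image (T U : eqType) (P : T -> Prop) (Q : U -> Prop) (f : T -> U) :
  covered P -> (forall y, Q y -> exists2 x, P x & y = f x) -> covered Q.
Proof.
move=> [L PL] QP; exists [seq f x | x <- L] => y /QP[x Px ->].
by apply: map_f; apply: PL.
Qed.

Lemma covered_seq (T : eqType) (P : T -> Prop) d : covered P ->
  covered (fun t : seq T => size t = d /\ forall x, x \in t -> P x).
Proof.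
move=> [L PL]; elim: d => [|d [LL IH]].
  by exists [:: [::]] => -[|x t] [].
exists [seq x :: t | x <- L, t <- LL] => -[|x t] [] //= [sz_t] Pt.
apply: (allpairs_f (fun (x : T) (t : seq T) => x :: t)).
  by apply/PL/Pt/mem_head.
by apply: IH; split=> // y ty; apply: Pt; rewrite inE ty orbT.
Qed.

(** Reduction modulo the monic equation [q] of [a] leaves remainders of bounded size over a finite
    ring. The division takes place over [subring_type], which keeps the coefficients of the
    remainder in [A]. *)
Lemma covered_adjoin (K : comNzRingType) (A : K -> Prop) a :
  subring_pred A -> covered A -> integral A a -> covered (adjoin A a).
Proof.
move=> subA covA [q [mon_q Aq qa0]].
apply: (covered_image (f := fun t : seq K => (Poly t).[a])
  (covered_seq (size q).-1 covA)) => _ [p Ap ->].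
have [p' p'E] := subring_poly_lift subA Ap.
have [q' q'E] := subring_poly_lift subA Aq.
have mon_q' : q' \is monic by apply: subring_monic_lift; rewrite q'E.
have size_q : size q = size q'.
  rewrite -q'E; exact: (size_map_inj_poly val_inj).
pose r := map_poly val (Pdiv.Ring.rmodp p' q').
have size_r : (size r <= (size q).-1)%N.
  apply: leq_trans (size_poly _ _) _.
  rewrite -ltnS prednK; last by rewrite lt0n size_poly_eq0 monic_neq0.
  by rewrite size_q Pdiv.Ring.ltn_rmodpN0 // monic_neq0.
have pa : p.[a] = r.[a].
  rewrite -p'E (Pdiv.RingMonic.rdivp_eq mon_q' p') rmorphD rmorphM /=.
  by rewrite hornerD hornerM q'E (eqP qa0) mulr0 add0r.
exists (mkseq (nth 0 r) (size q).-1).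
  rewrite size_mkseq; split=> // x /mapP[i _ ->].
  by rewrite coef_map; apply: subring_type_val.
rewrite pa; congr _.[a]; apply/polyP=> i; rewrite coef_Poly.
have [lt_i|le_i] := ltnP i (size q).-1; first by rewrite nth_mkseq.
rewrite nth_default; last exact: leq_trans le_i.
by rewrite nth_default ?size_mkseq.
Qed.

(** The generators are adjoined one at a time: each A[a] is again finite, and [K] remains integral
    over it. *)
Lemma covered_integral_gen (K : comNzRingType) (A : K -> Prop) (s : seq K) :
    subring_pred A -> covered A -> (forall x, integral A x) ->
    (forall x, ring_gen (fun y => A y \/ y \in s) x) ->
  covered (fun _ : K => True).
Proof.
elim: s A => [|a s IH] A subA covA int gen.
  by case: covA => L AL; exists L => x _; apply: AL; apply: gen => // y [].
have subAa := adjoin_subring subA a.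
apply: (IH (adjoin A a)) => //.
- exact: covered_adjoin.
- by move=> x; apply: integral_mono (int x) => y; apply: adjoin_base.
- move=> x T subT genT; apply: (gen x) => // y [Ay|].
    by apply: genT; left; apply: adjoin_base.
  rewrite inE => /predU1P[->|sy]; apply: genT; last by right.
  by left; apply: adjoin_gen.
Qed.

Section FinitelyGeneratedField.
Variable K : fieldType.

Let Zimg (x : K) := exists m : int, x = m%:~R.

Lemma Zimg_subring : subring_pred Zimg.
Proof.
split=> [|_ _ [m ->] [k ->]|_ _ [m ->] [k ->]]; first by exists 1.
  by exists (m - k); rewrite rmorphB.
by exists (m * k); rewrite rmorphM.
Qed.

(** Take a prime p > |m|. If p is nonzero in [K], its inverse lies in the image of Z[1/m], so
    [m ^+ k = p * z] holds in [K]. It fails in the integers since p does not divide m, so a nonzero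
    integer vanishes in [K]. *)
Lemma integral_localize_Zimg_pchar (m : int) :
    m%:~R != 0 :> K -> (forall x : K, integral (localize Zimg m%:~R) x) ->
  exists p, p \in [pchar K].
Proof.
move=> m0 int.
have [p lt_mp pr_p] := prime_above `|m|%N.
have [p0|p0] := eqVneq (p%:R : K) 0.
  by exists p; rewrite inE pr_p p0 eqxx.
have subL := localize_subring Zimg_subring (ex_intro _ m erefl).
have Lp : localize Zimg m%:~R p%:R.
  by apply: localize_base; exists p%:Z.
have [k [z zE]] := integral_inv_mem subL Lp (int _).
pose y := (m ^+ k - p%:Z * z)%R.
have y0 : y%:~R = 0 :> K.
  rewrite rmorphB rmorphM rmorphXn /= -zE mulrA divff // mul1r subrr //.
have yN0 : y != 0.
  rewrite subr_eq0; apply/eqP => myE.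
  have : (p %| `|m ^+ k|)%N by rewrite myE abszM dvdn_mulr.
  rewrite abszX Euclid_dvdX // => /andP[pm _].
  have m_gt0 : (0 < `|m|)%N.
    by rewrite lt0n absz_eq0; apply: contraNneq m0 => ->.
  by have := dvdn_leq m_gt0 pm; rewrite leqNgt lt_mp.
apply: (@natf0_pchar K `|y|%N); first by rewrite lt0n absz_eq0.
apply/eqP; move: y0; case: {yN0} y => j /=; first by rewrite -pmulrn.
by rewrite NegzE rmorphN /= -pmulrn => /eqP; rewrite oppr_eq0 => /eqP.
Qed.

Lemma finitely_generated_field_finite (s : seq K) :
  (forall x, ring_gen (fun y => y \in s) x) -> covered (fun _ : K => True).
Proof.
move=> gen.
have gen' x : ring_gen (fun y => Zimg y \/ y \in s) x.
  by move=> T subT genT; apply: gen => // y sy; apply: genT; right.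
have [_ [[m ->] m0] int] := zariski Zimg_subring gen'.
have [p pcharK] := integral_localize_Zimg_pchar m0 int.
have pr_p := pcharf_prime pcharK.
apply: (covered_integral_gen Zimg_subring _ _ gen').
  exists [seq i%:R | i <- iota 0 p] => _ [k ->].
  have p_gt0 := prime_gt0 pr_p.
  have kp : (k %% p)%Z = `|(k %% p)%Z|%N.
    by rewrite gez0_abs // modz_ge0 // eqz_nat -lt0n.
  have -> : k%:~R = `|(k %% p)%Z|%N%:R :> K.
    rewrite {1}(divz_eq k p) kp rmorphD rmorphM /= -!pmulrn.
    by rewrite (pcharf0 pcharK) mulr0 add0r.
  apply: map_f; rewrite mem_iota /= add0n -ltz_nat -kp.
  by rewrite ltz_pmod // ltz_nat.
move=> x; apply: integral_mono (int x) => y [k [z]].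
(* By Fermat, [m ^+ p = m] in [K], so inverting [m] adds nothing to the prime ring and [K] is
   integral over that finite ring. *)
have mV : (m%:~R : K)^-1 = m%:~R ^+ (p - 2).
  have mp : (m%:~R : K) ^+ p = m%:~R.
    by rewrite -(pFrobenius_autE pcharK) rmorph_int.
  apply: (mulIf m0); apply: (mulIf m0); rewrite mulVf // mul1r -mulrA -expr2.
  by rewrite -exprD subnK ?prime_gt1.
move=> yE; exists (z * (m ^+ (p - 2)) ^+ k).
rewrite rmorphM !rmorphXn /= -mV -yE -mulrA -exprMn divff // expr1n mulr1 //.
Qed.

End FinitelyGeneratedField.

(** * Division rings of finite dimension over their center *)

Section CenterField.
Variables (D : unitRingType) (divD : is_division_ring D).

Definition center_mem (_ : is_division_ring D) : {pred D} :=
  fun x => `[< central x >].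

Fact center_mem_closed : divring_closed (center_mem divD).
Proof.
split=> [|x y /asboolP cx /asboolP cy|x y /asboolP cx /asboolP cy];
    apply/asboolP => z.
- by rewrite mul1r mulr1.
- by rewrite mulrBl mulrBr cx cy.
- have cyV : GRing.comm z y^-1 by apply: commrV; apply: esym; apply: cy.
  by rewrite -mulrA -cyV !mulrA cx.
Qed.

HB.instance Definition _ :=
  GRing.isDivringClosed.Build D (center_mem divD) center_mem_closed.

Definition center_type := {x : D | x \in center_mem divD}.
HB.instance Definition _ := SubChoice.on center_type.
HB.instance Definition _ := [SubChoice_isSubUnitRing of center_type by <:].

Definition center_val (x : center_type) : D := val x.
HB.instance Definition _ := GRing.RMorphism.copy center_val (val : center_type -> D).

Lemma center_val_inj : injective center_val.
Proof. exact: val_inj. Qed.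

Lemma center_typeP (x : center_type) : central (center_val x).
Proof. by have /asboolP := valP x. Qed.

Lemma center_val_insubd x : central x -> center_val (insubd 0 x) = x.
Proof. by move=> /asboolP cx; apply: insubdK. Qed.

Fact center_mulC : commutative (@GRing.mul center_type).
Proof. by move=> x y; apply: val_inj; rewrite !rmorphM /=; apply: center_typeP. Qed.

HB.instance Definition _ :=
  GRing.PzRing_hasCommutativeMul.Build center_type center_mulC.

Fact center_field_axiom : GRing.field_axiom center_type.
Proof.
move=> x x0; have ux : val x \is a GRing.unit.
  by apply: divD; apply: contraNneq x0 => vx0; apply/eqP/val_inj.
apply/unitrP; have Vx : (val x)^-1 \in center_mem divD.
  by rewrite rpredV; apply: valP.
exists (Sub (val x)^-1 Vx); split; apply: val_inj; rewrite rmorphM rmorph1 /=.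
  exact: mulVr.
exact: mulrV.
Qed.

HB.instance Definition _ := 
  GRing.ComUnitRing_isField.Build center_type center_field_axiom.


End CenterField.

Section FiniteDimensional.
Variables (D : unitRingType) (divD : is_division_ring D).
Local Notation F := (center_type divD).

(** A relation with nonzero coefficient at [b ord0 = 1] involves another vector, which can be
    eliminated without touching 1. The independence reached makes the coefficient of 1 well defined,
    which suffices to read off a central element. *)
Lemma spanning_family_reduce k (b : 'I_k.+1 -> D) :
    b ord0 = 1 ->
    (forall x, exists c : 'I_k.+1 -> F, x = \sum_i center_val (c i) * b i) ->
  exists l, exists b' : 'I_l.+1 -> D, [/\ b' ord0 = 1,
    forall x, exists c : 'I_l.+1 -> F, x = \sum_i center_val (c i) * b' i &
    forall c : 'I_l.+1 -> F, \sum_i center_val (c i) * b' i = 0 -> c ord0 = 0].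
Proof.
elim: k b => [|k IH] b b0 span.
  exists 0%N, b; split=> // c; rewrite big_ord1 b0 mulr1 => c0.
  by apply: center_val_inj; rewrite rmorph0.
have [free|] := pselect (forall c : 'I_k.+2 -> F,
    \sum_i center_val (c i) * b i = 0 -> c ord0 = 0); first by exists k.+1, b.
move=> /existsNP[c /not_implyP[cb0 /eqP c00]].
have [i ci0] : exists i, c (lift ord0 i) != 0.
  apply: contrapT => /forallNP c0; move: c00.
  move: cb0; rewrite (bigD1_ord ord0) //= big1 ?addr0 => [|i _].
    by rewrite b0 mulr1 => v0 /negP; apply; apply/eqP/center_val_inj; rewrite rmorph0.
  by have /negP := c0 i; rewrite negbK => /eqP ->; rewrite raddf0 mul0r.
pose j := lift ord0 i; rewrite -/j in ci0.
have bjE : b j = \sum_l center_val (- (c j)^-1 * c (lift j l)) * b (lift j l).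
  move: cb0; rewrite (bigD1_ord j) //= => /eqP; rewrite addr_eq0 => /eqP cb.
  have -> : b j = center_val (c j)^-1 * (center_val (c j) * b j).
    by rewrite mulrA -rmorphM mulVf // rmorph1 mul1r.
  rewrite cb mulrN -mulNr mulr_sumr; apply: eq_bigr => l _.
  by rewrite rmorphM /= rmorphN mulrA.
apply: (IH (fun l => b (lift j l))).
  by rewrite -b0; congr (b _); apply: val_inj.
move=> x; have [d ->] := span x.
exists (fun l => d j * (- (c j)^-1 * c (lift j l)) + d (lift j l)).
rewrite (bigD1_ord j) //= {1}bjE mulr_sumr -big_split; apply: eq_bigr => l _ /=.
by rewrite rmorphD rmorphM /= mulrDl mulrA.
Qed.

(* The Artin-Tate argument: relative to a basis containing 1, the coordinates of
   the ring generators together with the structure constants generate the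
   center as a ring. *)
Lemma finitely_generated_center k (b : 'I_k.+1 -> D) (e : seq D) :
    b ord0 = 1 ->
    (forall x, exists c : 'I_k.+1 -> F, x = \sum_i center_val (c i) * b i) ->
    (forall c : 'I_k.+1 -> F, \sum_i center_val (c i) * b i = 0 -> c ord0 = 0) ->
    (forall x, ring_gen (fun y => y \in e) x) ->
  exists s : seq F, forall z : F, ring_gen (fun y => y \in s) z.
Proof.
move=> b0 span free gen.
have [crd crdE] := choice span.
exists (flatten [seq [seq crd x l | l <- enum 'I_k.+1] |
  x <- e ++ [seq b p.1 * b p.2 | p <- enum {: 'I_k.+1 * 'I_k.+1}]]).
set s := flatten _ => z T subT sT.
have T_crd x l : x \in e ++ [seq b p.1 * b p.2 | p <- enum {: 'I_k.+1 * 'I_k.+1}] ->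
    T (crd x l).
  by move=> ex; apply/sT/flatten_mapP; exists x => //; apply: map_f; rewrite mem_enum.
(* [W] is the span of the basis over [T]. It is a subring containing the generators [e], hence all
   of [D]; comparing [z] times 1 with its expansion in [W] then puts [z] in [T]. *)
pose W x := exists2 c : 'I_k.+1 -> F, (forall i, T (c i)) &
  x = \sum_i center_val (c i) * b i.
have W0 : W 0.
  exists (fun _ => 0); first by move=> _; apply: subring_pred0.
  by rewrite big1 // => i _; rewrite raddf0 mul0r.
have WD x y : W x -> W y -> W (x + y).
  move=> [c Tc ->] [d Td ->]; exists (fun i => c i + d i).
    by move=> i; apply: subring_predD.
  by rewrite -big_split; apply: eq_bigr => i _; rewrite rmorphD mulrDl.
have WZ (a : F) x : T a -> W x -> W (center_val a * x).
  move=> Ta [c Tc ->]; exists (fun i => a * c i).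
    by move=> i; apply: subring_predM.
  by rewrite mulr_sumr; apply: eq_bigr => i _; rewrite rmorphM mulrA.
have Wcrd x : x \in e ++ [seq b p.1 * b p.2 | p <- enum {: 'I_k.+1 * 'I_k.+1}] -> W x.
  by move=> ex; exists (crd x) => // i; apply: T_crd.
have subW : subring_pred W.
  split.
  - exists (fun i => if i == ord0 then 1 else 0).
      by move=> i; case: ifP => _; [apply: subring_pred1 | apply: subring_pred0].
    rewrite (bigD1 ord0) //= b0 rmorph1 mulr1 big1 ?addr0 // => i /negPf ->.
    by rewrite raddf0 mul0r.
  - move=> x y Wx Wy; apply: WD => //; rewrite -mulN1r.
    have -> : -1 = center_val (-1 : F) by rewrite rmorphN1.
    by apply: WZ => //; apply: subring_predN => //; apply: subring_pred1.
  - move=> _ _ [c Tc ->] [d Td ->]; rewrite mulr_suml.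
    apply: big_ind => // i _; rewrite -mulrA; apply: (WZ) => //.
    rewrite mulr_sumr; apply: big_ind => // j _.
    rewrite mulrA -(center_typeP (d j)) -mulrA; apply: WZ => //.
    apply: Wcrd; rewrite mem_cat; apply/orP; right.
    by apply: (map_f (fun p => b p.1 * b p.2) (x := (i, j))); rewrite mem_enum.
have [c Tc zE] : W (center_val z).
  by apply: gen => // x ex; apply: Wcrd; rewrite mem_cat ex.
suff -> : z = c ord0 by [].
apply/eqP; rewrite -subr_eq0; apply/eqP.
pose d i : F := (if i == ord0 then z else 0) - c i.
have := free d; rewrite /d eqxx; apply.
under eq_bigr do rewrite rmorphB mulrBl.
rewrite big_split sumrN -zE (bigD1 ord0) //= b0 mulr1.
rewrite big1 ?addr0 ?subrr // => i /negPf ->.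
by rewrite raddf0 mul0r.
Qed.

Lemma finitely_generated_division_ring_finite (e b : seq D) :
    (forall x, ring_gen (fun y => y \in e) x) ->
    (forall x, exists c : seq D, [/\ size c = size b,
       forall i, (i < size c)%N -> central (nth 0 c i) &
       x = \sum_(i < size b) nth 0 c i * nth 0 b i]) ->
  covered (fun _ : D => True).
Proof.
move=> gen span.
(* The reduction needs 1 as first vector: it is put in front of [b] with coefficient 0. *)
have span1 x : exists c : 'I_(size b).+1 -> F,
    x = \sum_i center_val (c i) * nth 0 (1 :: b) i.
  have [c [sz_c cen_c xE]] := span x.
  exists (fun i => insubd 0 (nth 0 (0 :: c) i)).
  rewrite big_ord_recl /= center_val_insubd; last by move=> y; rewrite mul0r mulr0.
  rewrite mul0r add0r xE.
  apply: eq_bigr => i _; rewrite center_val_insubd //=.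
  by apply: cen_c; rewrite sz_c add0n ltn_ord.
have [l [b' [b'0 span' free]]] :=
  spanning_family_reduce (b := fun i => nth 0 (1 :: b) (val i)) erefl span1.
have [s genF] := finitely_generated_center b'0 span' free gen.
have covF := covered_seq l.+1 (finitely_generated_field_finite genF).
apply: (covered_image (f := fun t : seq F => \sum_i center_val (nth 0 t (val i)) * b' i) covF).
move=> x _; have [c ->] := span' x.
exists (mkseq (fun i => c (inord i)) l.+1); first by rewrite size_mkseq.
by apply: eq_bigr => i _; rewrite nth_mkseq //= inord_val.
Qed.

End FiniteDimensional.

(** * Subgroups normalized by the transvections *)

Section Transvections.
Variables (D : unitRingType) (divD : is_division_ring D) (n : nat).
Implicit Types (u v w : 'cV[D]_n) (phi psi : 'rV[D]_n) (g h : 'M[D]_n) (a b : 'M[D]_1).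

(** If [phi *m v = 0], this is the transvection along [v] fixing the kernel of [phi]. Columns form a
    right vector space over [D], so their scalars are 1 x 1 matrices multiplied on the right. *)
Definition transv v phi : 'M[D]_n := 1%:M + v *m phi.

Lemma transvM v phi psi : phi *m v = 0 ->
  transv v phi *m transv v psi = transv v (phi + psi).
Proof.
move=> pv; rewrite /transv mulmxDl mul1mx mulmxDr mulmx1 -mulmxA (mulmxA phi) pv.
by rewrite mul0mx mulmx0 addr0 mulmxDr -addrA [v *m psi + _]addrC.
Qed.

Lemma transv_mull v phi u : transv v phi *m u = u + v *m (phi *m u).
Proof. by rewrite /transv mulmxDl mul1mx mulmxA. Qed.

Lemma transv_mulr v phi psi : psi *m transv v phi = psi + psi *m v *m phi.
Proof. by rewrite /transv mulmxDr mulmx1 mulmxA. Qed.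

Lemma transv0 v : transv v 0 = 1%:M.
Proof. by rewrite /transv mulmx0 addr0. Qed.

Lemma transvV v phi : phi *m v = 0 -> transv v phi *m transv v (- phi) = 1%:M.
Proof. by move=> pv; rewrite transvM // subrr transv0. Qed.

Lemma transvVl v phi : phi *m v = 0 -> transv v (- phi) *m transv v phi = 1%:M.
Proof. by move=> pv; rewrite transvM ?mulNmx ?pv ?oppr0 // addNr transv0. Qed.

Lemma transvC v phi psi : phi *m v = 0 -> psi *m v = 0 ->
  transv v phi *m transv v psi = transv v psi *m transv v phi.
Proof. by move=> pv qv; rewrite !transvM // addrC. Qed.

Lemma mx11_inv a : a != 0 -> exists2 b, a *m b = 1%:M & b *m a = 1%:M.
Proof.
rewrite [a]mx11_scalar => a0; have a00 : a 0 0 != 0.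
  by apply: contraNneq a0 => ->; rewrite raddf0.
exists ((a 0 0)^-1)%:M; rewrite -scalar_mxM; congr _%:M.
  by rewrite mulrV // divD.
by rewrite mulVr // divD.
Qed.

Lemma mx11_inv_neq0 a b : a *m b = 1%:M -> b != 0.
Proof.
move=> ab; apply/eqP => b0; move: ab; rewrite b0 mulmx0.
by move/matrixP => /(_ 0 0) /eqP; rewrite !mxE eq_sym oner_eq0.
Qed.

Definition dependent v u := exists a, u = v *m a.

Lemma separating_form v u : v != 0 -> ~ dependent v u ->
  exists2 phi : 'rV[D]_n, phi *m v = 0 & phi *m u != 0.
Proof.
move=> /cV0Pn[i vi] ind.
(* Coordinate [i] leaves [x] as the only candidate for [u = v x]. It fails at some [j], and the form
   below measures this failure. *)
pose x := (v i 0)^-1 * u i 0.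
have [j uj] : exists j, u j 0 - v j 0 * x != 0.
  apply: contrapT => /forallNP uN; apply: ind; exists x%:M; apply/colP => j.
  rewrite mxE big_ord1 !mxE eqxx mulr1n; apply/eqP; rewrite -subr_eq0.
  by apply: contrapT => /negP /uN.
exists (delta_mx 0 j - (v j 0 * (v i 0)^-1) *: delta_mx 0 i).
  rewrite mulmxBl -scalemxAl -!rowE; apply/matrixP => k l; rewrite !ord1 !mxE.
  by rewrite -mulrA mulVr ?mulr1 ?subrr // divD.
rewrite mulmxBl -scalemxAl -!rowE; apply: contraNneq uj => /matrixP/(_ 0 0).
by rewrite !mxE -mulrA => ->.
Qed.

Lemma nonvanishing_form v : v != 0 -> exists phi : 'rV[D]_n, phi *m v != 0.
Proof.
move=> /cV0Pn[i vi].
exists (delta_mx 0 i); rewrite -rowE; apply: contraNneq vi => /matrixP/(_ 0 0).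
by rewrite !mxE => ->.
Qed.

Lemma common_form (P : 'rV[D]_n -> Prop) u u' phi psi :
    (forall phi psi, P phi -> P psi -> P (phi + psi)) ->
    P phi -> P psi -> phi *m u != 0 -> psi *m u' != 0 ->
  exists2 chi, P chi & chi *m u != 0 /\ chi *m u' != 0.
Proof.
move=> PD Pphi Ppsi pu pu'.
have [pu'0|pu'0] := eqVneq (phi *m u') 0; last by exists phi.
have [qu0|qu0] := eqVneq (psi *m u) 0; last by exists psi.
exists (phi + psi); first exact: PD.
by rewrite !mulmxDl pu'0 qu0 addr0 add0r.
Qed.

(** The form [a *m phi] takes the value 1 both at [u] and at the rescaled vector [u' *m c]; the
    transvection along their difference carries one to the other. *)
Lemma transv_move u u' phi : phi *m u != 0 -> phi *m u' != 0 ->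
  exists w psi a, [/\ psi *m w = 0, a != 0, transv w psi *m u = u' *m a &
    forall v, phi *m v = 0 -> transv w psi *m v = v].
Proof.
move=> pu pu'.
have [a aV Va] := mx11_inv pu; have [b bV Vb] := mx11_inv pu'.
have psiu : (a *m phi) *m u = 1%:M by rewrite -mulmxA.
pose c := b *m (phi *m u).
have psiu' : (a *m phi) *m (u' *m c) = 1%:M.
  by rewrite /c mulmxA -(mulmxA a) -mulmxA (mulmxA _ b) bV mul1mx.
exists (u' *m c - u), (a *m phi), c; split.
- by rewrite mulmxBr psiu psiu' subrr.
- apply: (@mx11_inv_neq0 (a *m (phi *m u'))); rewrite /c mulmxA -(mulmxA a).
  by rewrite bV mulmx1.
- by rewrite /transv mulmxDl mul1mx -mulmxA psiu mulmx1 addrC subrK.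
- by move=> v pv; rewrite /transv mulmxDl mul1mx -!mulmxA pv !mulmx0 addr0.
Qed.

(** [e] is the analogue of a Weyl element of SL_2 for the dual pairs [v], [w] and [phi], [psi]: it
    satisfies [e *m v = - (w *m a')] and [psi *m e = a *m phi], so conjugation by it exchanges the
    two directions of transvections. *)
Lemma weyl_conj v w phi psi a a' x (e := transv (v *m a) phi *m
    transv (w *m a') (- psi) *m transv (v *m a) phi) :
    phi *m v = 0 -> psi *m w = 0 -> phi *m w = 1%:M -> psi *m v = 1%:M ->
    a *m a' = 1%:M -> a' *m a = 1%:M ->
  e *m transv v (x *m phi) = transv w (- (a' *m x *m a') *m psi) *m e.
Proof.
move=> pv qw pw qv aV Va.
have ev : e *m v = - (w *m a').
  rewrite /e -!mulmxA !transv_mull pv mulmx0 addr0 mulNmx qv mulmxN mulmx1.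
  rewrite mulmxBr pv sub0r mulmxA pw mul1mx mulmxN -mulmxA aV mulmx1.
  by rewrite addrAC subrr sub0r.
have qe : psi *m e = a *m phi.
  rewrite /e !mulmxA !transv_mulr mulmxA qv mul1mx mulmxDl mulmxA qw mul0mx add0r.
  rewrite [a *m phi *m _]mulmxA -[a *m phi *m w]mulmxA pw mulmx1 aV mul1mx.
  have -> : psi + a *m phi - psi = a *m phi by rewrite addrAC subrr add0r.
  by rewrite mulmxA -[a *m phi *m v]mulmxA pv mulmx0 !mul0mx addr0.
clearbody e; rewrite [in LHS]/transv [in RHS]/transv mulmxDr mulmx1 mulmxDl mul1mx.
congr (_ + _); rewrite !mulmxA ev -!mulmxA qe !mulNmx mulmxN.
by rewrite !mulmxA -(mulmxA _ a' a) Va mulmx1.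
Qed.

(** * Iwasawa's argument for a subgroup normalized by the transvections *)

Section NormalizedByTransvections.
Variable H : 'M[D]_n -> Prop.
Hypothesis subH : is_subgroup H (@GL D n).
Hypothesis normH : forall v phi h, phi *m v = 0 -> H h ->
  H (transv v (- phi) *m h *m transv v phi).

Let H1 : H 1%:M. Proof. by case: subH. Qed.
Let HM g h : H g -> H h -> H (g *m h). Proof. by case: subH => _ _ h3 _; apply: h3. Qed.

Let HV h : H h -> exists2 h', H h' & h *m h' = 1%:M /\ h' *m h = 1%:M.
Proof.
move=> Hh; case: subH => sHG _ _ HI; have [h' [hh' h'h]] := sHG _ Hh.
by exists h' => //; apply: HI Hh _ _.
Qed.

Let normHV v phi h : phi *m v = 0 -> H h ->
  H (transv v phi *m h *m transv v (- phi)).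
Proof.
by move=> pv Hh; rewrite -{1}[phi]opprK; apply: normH => //; rewrite mulNmx pv oppr0.
Qed.

Definition normalizer g g' :=
  [/\ g *m g' = 1%:M, g' *m g = 1%:M & forall h, H h -> H (g *m h *m g')].

Lemma normalizer_transv v phi : phi *m v = 0 ->
  normalizer (transv v phi) (transv v (- phi)).
Proof. by move=> pv; split=> [||h]; [exact: transvV | exact: transvVl | exact: normHV]. Qed.

Lemma normalizerM g1 g1' g2 g2' : normalizer g1 g1' -> normalizer g2 g2' ->
  normalizer (g1 *m g2) (g2' *m g1').
Proof.
move=> [g1V Vg1 n1] [g2V Vg2 n2]; split.
- by rewrite mulmxA -(mulmxA g1) g2V mulmx1.
- by rewrite mulmxA -(mulmxA g2') Vg1 mulmx1.
- by move=> h /n2/n1; rewrite !mulmxA.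
Qed.

(** One transvection moves the line of [v] to that of [v']. A second one moves the image of [u] to
    the line of [u']; its form is taken to vanish at [v'], so that it fixes [v']. *)
Lemma double_transitive v u v' u' :
    v != 0 -> ~ dependent v u -> v' != 0 -> ~ dependent v' u' ->
  exists g g' a b, [/\ normalizer g g', a != 0, b != 0, g *m v = v' *m a &
    g *m u = u' *m b].
Proof.
move=> v0 vu v'0 v'u'.
have [g [g' [a [ng a0 gv]]]] : exists g g' a,
    [/\ normalizer g g', a != 0 & g *m v = v' *m a].
  have [phi pv] := nonvanishing_form v0; have [psi pv'] := nonvanishing_form v'0.
  have [chi _ [cv cv']] := @common_form (fun _ => True) _ _ _ _
    (fun _ _ _ _ => I) I I pv pv'.
  have [w [rho [a [rw a0 gv _]]]] := transv_move cv cv'.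
  exists (transv w rho), (transv w (- rho)), a; split=> //.
  exact: normalizer_transv.
have [gV Vg _] := ng.
have [a' aV Va] := mx11_inv a0.
have ind : ~ dependent v' (g *m u).
  move=> [x ux]; apply: vu; exists (a' *m x).
  have : g' *m (g *m u) = g' *m (v' *m a) *m a' *m x.
    by rewrite ux -!mulmxA (mulmxA a) aV mul1mx.
  by rewrite -gv !mulmxA Vg !mul1mx -mulmxA.
have [phi pv' pu] := separating_form v'0 ind.
have [psi qv' qu'] := separating_form v'0 v'u'.
have [chi cv' [cu cu']] := @common_form (fun phi => phi *m v' = 0) _ _ _ _
  (fun phi psi pv qv => etrans (mulmxDl phi psi v') (etrans (congr2 +%R pv qv) (addr0 0)))
  pv' qv' pu qu'.
have [w [rho [b [rw b0 tu tfix]]]] := transv_move cu cu'.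
exists (transv w rho *m g), (g' *m transv w (- rho)), a, b; split=> //.
- by apply: normalizerM => //; apply: normalizer_transv.
- by rewrite -mulmxA gv mulmxA tfix.
- by rewrite -mulmxA tu.
Qed.

Hypothesis moveH : exists2 h, H h & exists w, ~ dependent w (h *m w).

(** Some [h] in [H] moves a vector [w] off its line. Conjugating [h] by an element that carries the
    lines of [w] and [h *m w] to those of [v] and [v'] gives the required element. *)
Lemma line_transitive v v' : v != 0 -> v' != 0 ->
  exists2 h, H h & exists2 a, a != 0 & h *m v = v' *m a.
Proof.
move=> v0 v'0; have [[x v'E]|ind] := pselect (dependent v v').
  exists 1%:M => //.
  have x0 : x != 0 by apply: contraNneq v'0 => x0; rewrite v'E x0 mulmx0.
  have [y xy yx] := mx11_inv x0; exists y; first exact: mx11_inv_neq0 xy.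
  by rewrite v'E mul1mx -mulmxA xy mulmx1.
have [h Hh [w wind]] := moveH.
have w0 : w != 0.
  by apply/eqP => w0; apply: wind; exists 0; rewrite w0 mulmx0 mul0mx.
have [g [g' [a [b [[gV Vg ng] a0 b0 gw ghw]]]]] := double_transitive w0 wind v0 ind.
have [a' aV Va] := mx11_inv a0.
exists (g *m h *m g'); first exact: ng.
exists (b *m a').
  have [b' bV Vb] := mx11_inv b0.
  apply: (@mx11_inv_neq0 (a *m b')); rewrite mulmxA -(mulmxA a) Vb mulmx1 //.
have -> : v = g *m w *m a' by rewrite gw -mulmxA aV mulmx1.
by rewrite !mulmxA -(mulmxA _ g') Vg mulmx1 -(mulmxA g) ghw.
Qed.

Section MainPoint.
Variables (v0 : 'cV[D]_n) (v0_neq0 : v0 != 0).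

(** The product T H, where T is the abelian group of transvections along [v0]; it is closed under
    products because T normalizes [H]. *)
Definition transvH g := exists phi h, [/\ phi *m v0 = 0, H h & g = transv v0 phi *m h].

(** Some [h] in [H] maps [v0] to the line of [v], so the given transvection is h t h^-1 with t along
    [v0], that is, t times (t^-1 h t) h^-1, whose second factor is in [H]. *)
Lemma transvH_transv v phi : phi *m v = 0 -> transvH (transv v phi).
Proof.
move=> pv; have [vz|vn0] := eqVneq v 0.
  exists 0, 1%:M; split; rewrite ?mul0mx //.
  by rewrite transv0 mulmx1 /transv vz mul0mx addr0.
have [h Hh [a a0 hv0]] := line_transitive v0_neq0 vn0.
have [h' Hh' [hV Vh]] := HV Hh; have [a' aV Va] := mx11_inv a0.
pose psi := a' *m phi *m h.
have psi0 : psi *m v0 = 0.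
  by rewrite /psi -!mulmxA hv0 (mulmxA phi) pv mul0mx mulmx0.
have tE : transv v phi = h *m transv v0 psi *m h'.
  rewrite /transv mulmxDr mulmx1 mulmxDl hV /psi; congr (_ + _).
  by rewrite !mulmxA hv0 -!mulmxA hV mulmx1 (mulmxA a) aV mul1mx.
exists psi, (transv v0 (- psi) *m h *m transv v0 psi *m h'); split=> //.
  by apply: HM => //; apply: normH.
by rewrite !mulmxA transvV // mul1mx tE.
Qed.

Lemma transvHM g1 g2 : transvH g1 -> transvH g2 -> transvH (g1 *m g2).
Proof.
move=> [p1 [h1 [p1v Hh1 ->]]] [p2 [h2 [p2v Hh2 ->]]].
exists (p1 + p2), (transv v0 (- p2) *m h1 *m transv v0 p2 *m h2); split.
- by rewrite mulmxDl p1v p2v addr0.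
- by apply: HM => //; apply: normH.
- by rewrite -transvM // !mulmxA -(mulmxA (transv v0 p1) (transv v0 p2)) transvV // mulmx1.
Qed.

(* Modulo [H] the group generated by the transvections is a quotient of the
   abelian group of transvections centered at [v0]. *)
Lemma transvH_conj e t t' : transvH e -> transvH t -> transvH t' ->
  e *m t = t' *m e -> exists2 h, H h & t = t' *m h.
Proof.
move=> [p [k [pv Hk ->]]] [p1 [k1 [p1v Hk1 ->]]] [p2 [k2 [p2v Hk2 ->]]] eq_et.
(* [x] and [y] are the [H]-parts of the two sides of [eq_et] once transvections along [v0] are moved
   to the left; these commute, so the one of [e] cancels. *)
pose x := transv v0 (- p1) *m k *m transv v0 p1 *m k1.
pose y := transv v0 (- p) *m k2 *m transv v0 p *m k.
have Hx : H x by apply: HM => //; apply: normH.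
have Hy : H y by apply: HM => //; apply: normH.
have xy : transv v0 p1 *m x = transv v0 p2 *m y.
  have : transv v0 (- p) *m (transv v0 p *m transv v0 p1 *m x) =
         transv v0 (- p) *m (transv v0 p *m transv v0 p2 *m y).
    congr (_ *m _); rewrite (transvC pv p2v) /x /y !mulmxA.
    rewrite -(mulmxA (transv v0 p) (transv v0 p1)) transvV // mulmx1.
    rewrite -(mulmxA (transv v0 p2) (transv v0 p)) transvV // mulmx1.
    by move: eq_et; rewrite !mulmxA.
  by rewrite !mulmxA transvVl // !mul1mx.
move: (x) (y) Hx Hy xy => {}x {}y Hx Hy xy.
have [x' Hx' [xV Vx]] := HV Hx; have [k2' Hk2' [k2V Vk2]] := HV Hk2.
exists (k2' *m y *m x' *m k1); first by apply: (HM); [apply: (HM); [apply: HM|]|].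
rewrite !mulmxA -(mulmxA (transv v0 p2) k2) k2V mulmx1 -xy.
by rewrite -(mulmxA _ x) xV mulmx1.
Qed.

End MainPoint.

(** Modulo [H], [weyl_conj] with scalar 1 and parameter [x], and with scalar [a] and parameter
    [a *m x *m a], yields the same transvection along [w]. Hence the two transvections along [v]
    agree modulo [H]. *)
Lemma transv_square v w phi psi a a' x :
    phi *m v = 0 -> psi *m w = 0 -> phi *m w = 1%:M -> psi *m v = 1%:M ->
    a *m a' = 1%:M -> a' *m a = 1%:M ->
  H (transv v ((a *m x *m a - x) *m phi)).
Proof.
move=> pv qw pw qv aV Va.
have v0 : v != 0.
  apply/eqP => vz; move: qv; rewrite vz mulmx0 => /matrixP/(_ 0 0)/eqP.
  by rewrite !mxE eq_sym oner_eq0.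
have xpv y : (y *m phi) *m v = 0 by rewrite -mulmxA pv mulmx0.
have yqw y : (y *m psi) *m w = 0 by rewrite -mulmxA qw mulmx0.
have conj b b' y : b *m b' = 1%:M -> b' *m b = 1%:M ->
    exists2 h, H h & transv v (y *m phi) = transv w (- (b' *m y *m b') *m psi) *m h.
  move=> bV Vb.
  apply: (transvH_conj (v0 := v) _ _ _ (weyl_conj y pv qw pw qv bV Vb)).
  - have vb : phi *m (v *m b) = 0 by rewrite mulmxA pv mul0mx.
    apply: transvHM; last exact: transvH_transv.
    apply: transvHM; first exact: transvH_transv.
    by apply: transvH_transv => //; rewrite mulNmx mulmxA qw mul0mx oppr0.
  - exact: transvH_transv.
  - exact: transvH_transv.
have [h1 Hh1 E1] := conj 1%:M 1%:M x (mulmx1 _) (mulmx1 _).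
have [h2 Hh2 E2] := conj a a' (a *m x *m a) aV Va.
rewrite mul1mx mulmx1 in E1.
rewrite !mulmxA Va mul1mx -(mulmxA x) aV mulmx1 in E2.
have [h1' Hh1' [h1V Vh1]] := HV Hh1.
rewrite mulmxBl addrC -transvM; last by rewrite mulNmx xpv oppr0.
have -> : transv v (a *m x *m a *m phi) = transv v (x *m phi) *m (h1' *m h2).
  by rewrite E1 E2 -!mulmxA (mulmxA h1) h1V mul1mx.
by rewrite mulmxA transvVl // mul1mx; apply: HM.
Qed.

Lemma transv_mem v phi : ~ covered (fun _ : D => True) -> phi *m v = 0 ->
  H (transv v phi).
Proof.
move=> infD pv.
have [vz|v0] := eqVneq v 0; first by rewrite /transv vz mul0mx addr0.
have [pz|p0] := eqVneq phi 0; first by rewrite pz transv0.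
have /rV0Pn[i pi0] := p0.
(* [w] and a multiple of [psi0] complete [v] and [phi] to the dual pairs needed for
   [transv_square]. *)
pose w : 'cV[D]_n := delta_mx i 0 *m ((phi 0 i)^-1)%:M.
have pw : phi *m w = 1%:M.
  rewrite /w mulmxA -colE; apply/matrixP => j k; rewrite !ord1 mxE big_ord1 !mxE.
  by rewrite eqxx mulr1n mulrV // divD.
have w0 : w != 0.
  apply/eqP => wz; move: pw; rewrite wz mulmx0 => /matrixP/(_ 0 0)/eqP.
  by rewrite !mxE eq_sym oner_eq0.
have ind : ~ dependent w v.
  move=> [x vE]; case/eqP: v0; rewrite vE.
  by move: pv; rewrite vE mulmxA pw mul1mx => ->; rewrite mulmx0.
have [psi0 q0w q0v] := separating_form w0 ind.
have [c cV Vc] := mx11_inv q0v.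
have qw : (c *m psi0) *m w = 0 by rewrite -mulmxA q0w mulmx0.
have qv : (c *m psi0) *m v = 1%:M by rewrite -mulmxA.
pose K x := H (transv v (x *: phi)).
have sq (a x : D) : a != 0 -> K (a * x * a - x).
  move=> a0; have ua := divD a0; rewrite /K -mul_scalar_mx.
  rewrite raddfB /= !scalar_mxM.
  by apply: (transv_square (a' := (a^-1)%:M) _ pv qw pw qv); rewrite -scalar_mxM ?mulrV ?mulVr.
have KD x y : K x -> K y -> K (x + y).
  rewrite /K scalerDl => Kx Ky; rewrite -transvM; first exact: HM.
  by rewrite -scalemxAl pv scaler0.
(* Taking [x = (c' - 1)^-1] puts 1 in [K]. *)
suff [c' c'1 Kc] : exists2 c' : D, c' != 1 & forall x, K (c' * x - x).
  have uc : c' - 1 \is a GRing.unit by apply: divD; rewrite subr_eq0.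
  have := Kc ((c' - 1)^-1); rewrite -{2}[(c' - 1)^-1]mul1r -mulrBl mulrV // /K.
  by rewrite scale1r.
have [comm|] := pselect (forall a b : D, a * b = b * a).
  have [a [a0 a1 aN1]] : exists a : D, [/\ a != 0, a != 1 & a != -1].
    apply: contrapT => noa; apply: infD; exists [:: 0; 1; -1] => a _.
    apply: contrapT => /negP; rewrite !inE !negb_or => /and3P[? ? ?].
    by apply: noa; exists a.
  (* In the commutative case [a * x * a] is [a * a * x], and [a] other than 0, 1 and -1 exists
     because [D] is infinite. *)
  exists (a * a); last by move=> x; rewrite -mulrA (comm a x) mulrA; apply: sq.
  have ua1 : a - 1 \is a GRing.unit by apply: divD; rewrite subr_eq0.
  apply: contraNneq aN1 => aa1; rewrite -subr_eq0 opprK; apply/eqP.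
  apply: (mulrI ua1); rewrite mulr0 mulrDr mulr1 mulrBl aa1 mul1r.
  by rewrite addrA subrK subrr.
move=> /existsNP[a /existsNP[b ab]].
have a0 : a != 0 by apply/eqP => az; apply: ab; rewrite az mul0r mulr0.
have b0 : b != 0 by apply/eqP => bz; apply: ab; rewrite bz mul0r mulr0.
have uab : a * b \is a GRing.unit by rewrite unitrMl divD.
have d0 : (a * b)^-1 != 0 by rewrite invr_eq0; apply: contraTneq uab => ->; rewrite unitr0.
(* Applying [sq] in turn with [a], [b] and [(a * b)^-1] telescopes: the final product is
   [(a * b)^-1 * (b * a) * x], with multiplier different from 1 as [a] and [b] do not commute. *)
exists ((a * b)^-1 * (b * a)).
  by apply/eqP => /(congr1 (fun z => a * b * z)); rewrite mulr1 mulVKr // => /esym.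
move=> x.
have := KD _ _ (sq _ (b * (a * x * a) * b) d0) (KD _ _ (sq _ (a * x * a) b0) (sq _ x a0)).
rewrite addrA subrKA subrKA.
have -> : b * (a * x * a) * b = (b * a * x) * (a * b) by rewrite !mulrA.
by rewrite (mulrA _ (b * a * x)) mulrK // (mulrA _ (b * a)).
Qed.

End NormalizedByTransvections.
End Transvections.

(** * Subnormal subgroups *)

(** Basis vectors force [h] to be diagonal, and the vectors e_i + e_j c give
    [h j j * c = c * h i i]. The case c = 1 makes the diagonal constant, and general c makes it
    central. *)
Lemma line_stable_scalar (D : unitRingType) (n : nat) (h : 'M[D]_n) :
    (2 <= n)%N -> invertible h -> (forall w : 'cV[D]_n, dependent w (h *m w)) ->
  exists a : D, [/\ central a, a != 0 & h = a%:M].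
Proof.
move=> n2 [h' [hh' _]] stab.
have stabE i j (c : D) : i != j -> h i j = 0 /\ h j j * c = c * h i i.
  move=> ij.
  have col0 k l : k != l -> h k l = 0.
    move=> kl; have [x] := stab (delta_mx l 0); rewrite -colE => /colP/(_ k).
    by rewrite !mxE big_ord1 !mxE (negPf kl) /= mul0r.
  split; first exact: col0.
  have [x hx] := stab (delta_mx i 0 + delta_mx j 0 *m c%:M).
  rewrite mulmxDr mulmxA -!colE mulmxDl in hx.
  have := congr1 (fun v : 'cV_n => v i 0) hx; rewrite !mxE !big_ord1 !mxE !big_ord1 !mxE.
  rewrite !eqxx (negPf ij) (col0 i j) //= !mul0r mul1r !addr0 => ->.
  have := congr1 (fun v : 'cV_n => v j 0) hx; rewrite !mxE !big_ord1 !mxE !big_ord1 !mxE.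
  by rewrite !eqxx eq_sym (negPf ij) (col0 j i) 1?eq_sym //= mulr1n mul0r mul1r !add0r.
pose i0 := Ordinal (ltn_trans (ltnSn 0) n2); pose i1 := Ordinal n2.
have diag j : h j j = h i0 i0.
  have [->//|ij] := eqVneq i0 j.
  by have [_] := stabE i0 j 1 ij; rewrite mulr1 mul1r.
have hE : h = (h i0 i0)%:M.
  apply/matrixP => i j; rewrite mxE; have [->|ij] := eqVneq i j.
    by rewrite mulr1n diag.
  by rewrite mulr0n; case: (stabE i j 1 ij).
exists (h i0 i0); split=> // [c|].
  by have [_] := stabE i0 i1 c isT; rewrite diag.
apply/eqP => h0; move: hh'; rewrite hE h0 raddf0 mul0mx => /matrixP/(_ i0 i0)/eqP.
by rewrite !mxE eqxx eq_sym oner_eq0.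
Qed.

Lemma covered_matrix (D : nzRingType) m n :
  covered (fun _ : D => True) -> covered (fun _ : 'M[D]_(m, n) => True).
Proof.
move=> /(covered_seq (m * n)) covD.
apply: (covered_image (f := fun t => vec_mx (\row_(i < m * n) nth 0 t i)) covD).
move=> A _; exists [seq mxvec A 0 i | i <- enum 'I_(m * n)].
  by rewrite size_map size_enum_ord.
rewrite -[LHS]mxvecK; congr vec_mx; apply/rowP => i; rewrite mxE.
by rewrite (nth_map i) ?size_enum_ord // nth_ord_enum.
Qed.

Section Subnormal.
Variables (D : unitRingType) (divD : is_division_ring D) (n : nat).
Implicit Types (H G N : 'M[D]_n -> Prop).

Lemma transv_GL (v : 'cV[D]_n) (phi : 'rV[D]_n) : phi *m v = 0 -> GL (transv v phi).
Proof. by move=> pv; exists (transv v (- phi)); rewrite transvV ?transvVl. Qed.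

Lemma normal_transv H G : ~ covered (fun _ : D => True) ->
    is_subgroup H (@GL D n) ->
    (forall v phi, phi *m v = 0 -> G (transv v phi)) -> is_normal H G ->
    (exists2 h, H h & exists w : 'cV[D]_n, ~ dependent w (h *m w)) ->
  forall v phi, phi *m v = 0 -> H (transv v phi).
Proof.
move=> infD subH Gt [_ nHG] moveH v phi pv.
apply: (transv_mem divD) => // u psi h pu Hh.
by apply: nHG => //; [exact: Gt | exact: transvV | exact: transvVl].
Qed.

(** The element [h] climbs the chain, so every term moves a line. Descending from GL, each term is
    normalized by the transvections contained in the term above it, and so contains them all
    itself. *)
Lemma subnormal_transv N : ~ covered (fun _ : D => True) -> subnormal_GL N ->
    (exists2 h, N h & exists w : 'cV[D]_n, ~ dependent w (h *m w)) ->
  is_subgroup N (@GL D n) /\ forall v phi, phi *m v = 0 -> N (transv v phi).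
Proof.
move=> infD [k [C [C0 Ck nC]]] [h Nh wh].
have up i : (i <= k)%N -> C i h.
  elim: i => [_|i IH lt_ik]; first exact/C0.
  by have [[sC _ _ _] _] := nC i lt_ik; apply/sC/IH/ltnW.
have GL1 : GL (1%:M : 'M[D]_n) by exists 1%:M; rewrite mulmx1.
have down i : (i <= k)%N ->
    is_subgroup (C (k - i)%N) (@GL D n) /\
    forall v phi, phi *m v = 0 -> C (k - i)%N (transv v phi).
  elim: i => [_|i IH lt_ik].
    rewrite subn0; split; last by move=> v phi pv; apply/Ck/transv_GL.
    split=> [A /Ck//||A B /Ck[A' [AA' A'A]] /Ck[B' [BB' B'B]]|A B _ AB BA].
    - exact/Ck.
    - apply/Ck; exists (B' *m A'); split.
        by rewrite mulmxA -(mulmxA A) BB' mulmx1.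
      by rewrite mulmxA -(mulmxA B') A'A mulmx1.
    - by apply/Ck; exists A.
  have [[sG _ _ _] Gt] := IH (ltnW lt_ik).
  have lt_k : (k - i.+1 < k)%N by rewrite ltn_subrL (leq_ltn_trans _ lt_ik).
  have nor := nC _ lt_k; rewrite subnSK // in nor.
  have subH : is_subgroup (C (k - i.+1)%N) (@GL D n).
    by have [[sH ? ? ?] _] := nor; split=> // A /sH/sG.
  split=> //; apply: normal_transv nor _ => //.
  by exists h => //; apply/up/ltnW.
have := down k (leqnn k); rewrite subnn => -[[sG G1 GM GV] Ct].
split; last by move=> v phi /Ct /C0.
split=> [A /C0/sG //||A B /C0 CA /C0 CB|A B /C0 CA AB BA]; apply/C0 => //.
- exact: GM.
- exact: GV CA AB BA.
Qed.

(** For a subring [S], the invertible matrices with entries in [S] whose inverses also have entries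
    in [S] form a subgroup; [e] collects the entries of the generators and of their inverses. *)
Lemma finitely_generated_entries N : is_subgroup N (@GL D n) -> finitely_generated N ->
  exists e : seq D, forall A i j, N A -> ring_gen (fun y => y \in e) (A i j).
Proof.
move=> [NGL N1 NM NV] [s genN].
have sN B : B \in s -> N B by move=> sB; apply/genN => H _; apply.
have /choice[inv invP] (B : 'M[D]_n) : exists B',
    N B -> B *m B' = 1%:M /\ B' *m B = 1%:M.
  have [NB|nNB] := pselect (N B); last by exists 1%:M.
  by have [B' HB'] := NGL _ NB; exists B'.
pose entries (A : 'M[D]_n) := [seq A p.1 p.2 | p <- enum {: 'I_n * 'I_n}].
exists (flatten [seq entries A | A <- s ++ map inv s]) => A i j NA S subS genS.
have Sentries B : B \in s ++ map inv s -> forall i j, S (B i j).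
  move=> sB k l; apply: genS; apply/flatten_mapP; exists B => //.
  by apply: (map_f (fun p => B p.1 p.2) (x := (k, l))); rewrite mem_enum.
pose H (B : 'M[D]_n) := (forall i j, S (B i j)) /\ exists B' : 'M[D]_n,
  [/\ B *m B' = 1%:M, B' *m B = 1%:M & forall i j, S (B' i j)].
have SM (B C : 'M[D]_n) : (forall i j, S (B i j)) -> (forall i j, S (C i j)) ->
    forall i j, S ((B *m C) i j).
  move=> SB SC k l; rewrite mxE; apply: subring_pred_sum => // m _.
  exact: subring_predM.
have S1 k l : S ((1%:M : 'M[D]_n) k l).
  by rewrite mxE; case: (k == l); [apply: subring_pred1 | apply: subring_pred0].
have [] // : H A.
apply: (proj1 (genN A) NA) => [|B sB].
  split=> [B [_ [B' [BB' B'B _]]]||B C [SB [B' [BB' B'B SB']]] [SC [C' [CC' C'C SC']]]|].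
  - by exists B'.
  - by split=> //; exists 1%:M; rewrite mulmx1.
  - split; first exact: SM.
    exists (C' *m B'); split; last exact: SM.
      by rewrite mulmxA -(mulmxA B) CC' mulmx1.
    by rewrite mulmxA -(mulmxA C') B'B mulmx1.
  - move=> B C [SB [B' [BB' B'B SB']]] BC CB.
    have CE : C = B' by rewrite -[C]mul1mx -B'B -mulmxA BC mulmx1.
    by rewrite CE; split=> //; exists B.
have [BB' B'B] := invP B (sN _ sB).
split; first by apply: Sentries; rewrite mem_cat sB.
exists (inv B); split=> //.
by apply: Sentries; rewrite mem_cat map_f ?orbT.
Qed.

End Subnormal.

Theorem theorem5p7 (D : unitRingType) (n : nat) (N : 'M[D]_n -> Prop) :
  is_division_ring D -> weakly_locally_finite D -> (2 <= n)%N ->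
  subnormal_GL N -> infinite_set N -> finitely_generated N ->
  forall A, N A -> exists a : D, [/\ central a, a != 0 & A = a%:M].
Proof.
move=> divD wlfD n2 subnN infN fgN A NA.
have infD : ~ covered (fun _ : D => True).
  by move=> /(covered_matrix n n)[L LP]; apply: infN; exists L => B _; apply: LP.
have GLN B : N B -> GL B.
  have [k [C [C0 Ck nC]]] := subnN.
  move=> /C0 CB; apply/Ck; elim: {1 3}k (leqnn k) => // i IH lt_ik.
  by have [[sC _ _ _] _] := nC i lt_ik; apply/sC/IH/ltnW.
apply: (line_stable_scalar n2 (GLN _ NA)) => w0; apply: contrapT => w0N.
have [subN Nt] : is_subgroup N (@GL D n) /\
    forall v phi, phi *m v = 0 -> N (transv v phi).
  by apply: subnormal_transv => //; exists A => //; exists w0.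
have [e genN] := finitely_generated_entries subN fgN.
(* Each [x] is an entry of a transvection in [N], namely the one with [x] in position (0, 1). *)
have gen x : ring_gen (fun y => y \in e) x.
  pose i0 := Ordinal (ltn_trans (ltnSn 0) n2); pose i1 := Ordinal n2.
  have pv : (x *: delta_mx 0 i1 : 'rV[D]_n) *m (delta_mx i0 0 : 'cV[D]_n) = 0.
    by rewrite -scalemxAl mul_delta_mx_0 // scaler0.
  have := genN _ i0 i1 (Nt _ _ pv).
  by rewrite /transv !mxE big_ord1 !mxE !eqxx /= mul1r mulr1 add0r.
(* Since [e] generates [D], weak local finiteness applied to [e] concerns [D] and its own center. *)
have divgen_all x : divgen e x.
  move=> S [S0 S1 SB SM _] eS; apply: (gen x) => //.
have [b [_ span]] := wlfD e.
apply: infD; apply: (finitely_generated_division_ring_finite divD gen (b := b)) => x.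
have [c [sz_c cen_c xE]] := span x (divgen_all x).
by exists c; split=> // i /cen_c[_ cen] y; apply: cen.
Qed.
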